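(* For every finite sequence $Q$ of elements of $\{1,\dots,n-1\}$, $$t_k(Q)\le2\ \Longrightarrow\ t_{k+2}(Q)\le3,\qquad 3\le k\le n-4.$$ Consequently, for every $n\times n$ nonsingular totally nonnegative matrix $B$, $$\Delta_{L_k,R_k}(B^2)>0\ \Longrightarrow\ \Delta_{L_{k+2},R_{k+2}}(B^3)>0,\qquad 3\le k\le n-4.$$ For every $n\times n$ oscillatory matrix $A$, $$e_k(A)\le2\ \Longrightarrow\ e_{k+2}(A)\le3,\qquad 3\le k\le n-4,$$ and also $$e_{k+2}(A)\le2\ \Longrightarrow\ e_k(A)\le3,\qquad 2\le k\le n-5.$$
   Context: All matrices are real. A matrix is totally nonnegative (TN) if all its minors are $\ge0$ and totally positive (TP) if all its minors are $>0$; a square TN matrix is oscillatory if some positive power of it is TP. $\Delta_{I,J}(B)=\det B[I,J]$ is the minor with row set $I$ and column set $J$. $L_k=\{1,\dots,k\}$ and $R_k=\{n-k+1,\dots,n\}$. For an $n\times n$ oscillatory matrix $A$ and $1\le k\le n$, $e_k(A)=\min\{m\ge1:\text{all minors of order }k\text{ of }A^m\text{ are positive}\}$. For $a\in\{1,\dots,n-1\}$ and $I\subseteq\{1,\dots,n\}$, let $c_a^+(I)=(I\setminus\{a\})\cup\{a+1\}$ if $a\in I$ and $a+1\notin I$, and $c_a^+(I)=I$ otherwise. For a finite sequence $Q=(q_1,\dots,q_\ell)$ in $\{1,\dots,n-1\}$, a $Q$-pass applies $c_{q_1}^+,\dots,c_{q_\ell}^+$ successively, in that order ($c_{q_1}^+$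 first). $t_k(Q)$ is the least number $m\ge1$ of repeated $Q$-passes carrying $L_k$ to $R_k$, with $t_k(Q)=\infty$ if this never occurs. *)

(* Defs.v *)
From HB Require Import structures.
From mathcomp Require Import all_boot all_order all_algebra.
From mathcomp Require Import boolp reals.

Set Implicit Arguments.
Unset Strict Implicit.
Unset Printing Implicit Defensive.

Import Order.TTheory GRing.Theory Num.Theory.
Local Open Scope ring_scope.

(* Indices are 0-based throughout: the index i of {1, ..., n} is the element  *)
(* i - 1 of 'I_n, and a in {1, ..., n-1} is the element a - 1 of 'I_n.-1.     *)

(* The least m >= 1 satisfying P; None stands for infinity. *)
Definition least_pos (P : nat -> Prop) : option nat :=
  if pselect (exists m, `[< (0 < m)%N /\ P m >]) is left h
  then Some (ex_minn h) else None.

Definition leqoo (t : option nat) (b : nat) : bool :=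
  if t is Some m then (m <= b)%N else false.

Section Minors.
Variable R : realType.

(* enum_val lists a set of ordinals in increasing order. *)
Definition submx_set m n (B : 'M[R]_(m, n)) (I : {set 'I_m}) (J : {set 'I_n}) :
  'M[R]_(#|I|, #|J|) := \matrix_(i, j) B (enum_val i) (enum_val j).

(* conform_mx only identifies the dimensions #|I| and #|J|; the value is      *)
(* meaningful, and is only used, when #|I| = #|J|.                            *)
Definition minor m n (B : 'M[R]_(m, n)) (I : {set 'I_m}) (J : {set 'I_n}) : R :=
  \det (conform_mx (0 : 'M[R]_#|I|) (submx_set B I J)).

Definition totally_nonnegative m n (B : 'M[R]_(m, n)) : Prop :=
  forall (I : {set 'I_m}) (J : {set 'I_n}), #|I| = #|J| -> 0 <= minor B I J.

Definition totally_positive m n (B : 'M[R]_(m, n)) : Prop :=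
  forall (I : {set 'I_m}) (J : {set 'I_n}), #|I| = #|J| -> 0 < minor B I J.

Definition oscillatory n (A : 'M[R]_n) : Prop :=
  totally_nonnegative A /\
  exists m : nat, (0 < m)%N /\ totally_positive (A ^+ m).

Definition minors_pos k n (B : 'M[R]_n) : Prop :=
  forall I J : {set 'I_n}, #|I| = k -> #|J| = k -> 0 < minor B I J.

Definition exponent k n (A : 'M[R]_n) : option nat :=
  least_pos (fun m => minors_pos k (A ^+ m)).

End Minors.

Definition Lset n k : {set 'I_n} := [set i : 'I_n | (i < k)%N].

Definition Rset n k : {set 'I_n} := [set i : 'I_n | (n - k <= i)%N].

Section Passes.
Variable n : nat.

Fact up_subproof (a : 'I_n.-1) : (a.+1 < n)%N.
Proof. by rewrite -ltn_predRL. Qed.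

Definition here (a : 'I_n.-1) : 'I_n := widen_ord (leq_pred n) a.

Definition up (a : 'I_n.-1) : 'I_n := Ordinal (up_subproof a).

Definition cplus (a : 'I_n.-1) (I : {set 'I_n}) : {set 'I_n} :=
  if (here a \in I) && (up a \notin I) then up a |: (I :\ here a) else I.

Definition pass (Q : seq 'I_n.-1) (I : {set 'I_n}) : {set 'I_n} :=
  foldl (fun J a => cplus a J) I Q.

Definition pass_time k (Q : seq 'I_n.-1) : option nat :=
  least_pos (fun m => iter m (pass Q) (Lset n k) = Rset n k).

End Passes.

(* Main.v *)
Require Import Defs.
From HB Require Import structures.
From mathcomp Require Import all_boot all_order all_algebra.
From mathcomp Require Import boolp reals.
From mathcomp Require Import perm zify ring.

Set Implicit Arguments.
Unset Strict Implicit.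
Unset Printing Implicit Defensive.

Import Order.TTheory GRing.Theory Num.Theory.
Local Open Scope ring_scope.

(** A pass, like an invertible totally nonnegative matrix B, is governed by a two-index
count N(y, x): for a word Q it is the number of elements that a pass carries from the
initial segment of length y to positions at least x, and for B it
is the rank of the corner of B formed by its first y rows and its columns from x
on.  In both cases N has the shape #{i < y : w(i) >= x} of the corner counts of a
permutation w, and iterating the process amounts to a (min, +) product:
the count of a product at (y, x) is the minimum over z of N(y, z) + N'(z, x).
Carrying L_k to R_k in m steps, or having a nonzero corner minor of order k in
the m-th power, says that the m-fold (min, +) power of N at (k, n - k) is at least
k.  So all the claims reduce to one inequality about corner counts,
[two_to_three_steps], and its image under the symmetry w -> w^-1 of corner counts
([corner_count_dual]), which exchanges k and n - k and thereby turns the step from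
k to k + 2 into a step from k + 2 to k.

For words, the upper bound on counts (any z gives a bound) follows from the
fact that passes respect inclusion of sets, and the lower bound (some z attains
it) from an induction on the word, since one letter changes the count at one
position, to a minimum of three old values.

For matrices the upper bound is subadditivity of rank.  The lower bound uses
total nonnegativity.  If the columns S + c of the first y rows of an invertible
totally nonnegative matrix are independent and d < c is outside S, then S + d is
independent too ([column_exchange]): otherwise the Desnanot-Jacobi identity for
sets of rows and columns ([minor_desnanot]) equates a nonnegative number with a
negative one.  So the independent sets of columns are closed under
moving elements down, and a counting argument on such families
([shifted_transversal]) replaces the general matroid intersection theorem: it
suffices to compare counts on intervals.  The common independent set that it
gives yields a positive term in the Cauchy-Binet expansion, where all other terms
are nonnegative ([corner_mulmx_ge]).

Finally, for an invertible totally nonnegative matrix, positivity of the two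
extreme corner minors of order k, the upper right and the lower left one, forces
all minors of order k to be positive ([minors_pos_corners]): the exchange property
gives all minors on the first k rows or the first k columns, and Desnanot-Jacobi
propagates positivity from these.  Applied to the cube of an
oscillatory matrix and to its transpose, this gives the claims on exponents. *)

(** * An inequality for corner counts *)

(** The properties of N(y, x) = #{i < y : w(i) >= x}, for w a permutation of
{0, ..., n-1}, that the inequality below depends on; the rank of a corner of an
invertible matrix has them as well. *)
Record corner_count (n : nat) (N : nat -> nat -> nat) : Prop := CornerCount {
  cc_ge : forall y x, (y <= n)%N -> (x <= n)%N -> (y <= x + N y x)%N;
  cc_up : forall y y' x, (y <= y' <= n)%N -> (x <= n)%N ->
    (N y x <= N y' x <= N y x + (y' - y))%N;
  cc_down : forall y x x', (y <= n)%N -> (x <= x' <= n)%N ->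
    (N y x' <= N y x <= N y x' + (x' - x))%N;
  cc_monge : forall y y' x x', (y <= y' <= n)%N -> (x <= x' <= n)%N ->
    (N y x + N y' x' <= N y x' + N y' x)%N }.

(** For the count of a permutation w this is the count of its inverse. *)
Lemma corner_count_dual n N : corner_count n N ->
  corner_count n (fun y x => (N x y + y - x)%N).
Proof.
move=> [ge up down monge]; split.
- move=> y x hy hx; have := ge x y hx hy; lia.
- move=> y y' x hy hx.
  have := ge x y hx; have := ge x y' hx; have := down x y y' hx hy; lia.
- move=> y x x' hy hx.
  have := ge x y; have := ge x' y; have := up x x' y hx hy; lia.
- move=> y y' x x' hy hx; have := monge x x' y y' hx hy.
  have := ge x y; have := ge x' y; have := ge x y'; have := ge x' y'; lia.
Qed.

(** Write b = n - k.  If z < k, the hypothesis at z' together with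
N(k + 2, z) >= k + 2 - z already suffices, and symmetrically if z' > b.
Otherwise k <= z and z' <= b.  Then monotonicity and k >= 3 settle z < z', and
for z' <= z the Monge inequality on rows {k, z} and columns {z', b} is combined
with k >= 3 and b >= 4. *)
Lemma two_to_three_steps n N k : corner_count n N -> (3 <= k)%N -> (k + 4 <= n)%N ->
  (forall z, (z <= n)%N -> (k <= N k z + N z (n - k))%N) ->
  forall z z', (z <= n)%N -> (z' <= n)%N ->
  (k + 2 <= N (k + 2) z + N z z' + N z' (n - (k + 2)))%N.
Proof.
move=> [ge up down monge] k3 k4 H z z' hz hz'.
have [b Eb] : exists b, n = (k + b)%N by exists (n - k)%N; lia.
have Hz := H z hz; have Hz' := H z' hz'.
rewrite Eb in hz hz' Hz Hz' ge up down monge k4 *.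
have E1 : (k + b - k = b)%N by lia.
have E2 : (k + b - (k + 2) = b - 2)%N by lia.
rewrite E1 in Hz Hz'; rewrite E2 {H E1 E2 Eb}.
have p_ge := ge (k + 2)%N z; have r_ge := ge z' (b - 2)%N.
have q_ge := ge z z'.
have P_le : (N k z <= N (k + 2) z)%N.
  by have := up k (k + 2)%N z; lia.
have S_le : (N z' b <= N z' (b - 2))%N.
  by have := down z' (b - 2)%N b; lia.
have [zk|kz] := ltnP z k.
  have := up z k z'; lia.
have [bz|zb] := ltnP b z'.
  have := down z b z'; lia.
have := up k z z'; have := down z z' b.
have [zz|zz] := ltnP z z'.
  have := down k z z'; have := up z z' b; lia.
have M := monge k z z' b.
(* With M = N k b, P = N k z and S = N z' b, the hypotheses and the Monge
   inequality give M >= 2k - P - S - N z z', while M - P <= z - b and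
   M - S <= k - z' when the right-hand sides are nonnegative. *)
have [zb'|bz'] := leqP z b.
  have := down k z b; have := up k z z'; lia.
have := down k b z.
have [kz'|zk'] := leqP k z'; first by have := up k z' b; lia.
have := up z' k b; lia.
Qed.

(** * Passes *)

Lemma leqoo_least_pos (P : nat -> Prop) b :
  leqoo (least_pos P) b <-> exists m, (0 < m <= b)%N /\ P m.
Proof.
rewrite /least_pos; case: pselect => [h|h] /=.
  case: ex_minnP => m /asboolP [m0 Pm] min; split => [mb|[m' [/andP[m'0 m'b] Pm']]].
    by exists m; rewrite m0.
  by apply: leq_trans m'b; apply: min; apply/asboolP.
by split => // -[m [/andP[m0 _] Pm]]; case: h; exists m; apply/asboolP.
Qed.

Lemma in_Lset n k (i : 'I_n) : (i \in Lset n k) = (i < k)%N.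
Proof. by rewrite inE. Qed.

Lemma Rset_setC n k : Rset n k = ~: Lset n (n - k).
Proof. by apply/setP => i; rewrite !inE -leqNgt. Qed.

Lemma card_Lset n k : (k <= n)%N -> #|Lset n k| = k.
Proof.
move=> kn; rewrite -sum1_card (eq_bigl (fun i : 'I_n => i < k)%N).
  by rewrite -(big_ord_widen n (fun=> 1%N) kn) sum1_card card_ord.
by move=> i; rewrite inE.
Qed.

Lemma card_LsetC n k : (k <= n)%N -> #|~: Lset n k| = (n - k)%N.
Proof. by move=> kn; rewrite cardsCs setCK card_ord card_Lset. Qed.

Lemma card_Rset n k : (k <= n)%N -> #|Rset n k| = k.
Proof. by move=> kn; rewrite Rset_setC card_LsetC ?leq_subr ?subKn. Qed.

Lemma Lset_sub n k k' : (k <= k')%N -> Lset n k \subset Lset n k'.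
Proof. by move=> kk; apply/subsetP => i; rewrite !inE => /leq_trans; apply. Qed.

Definition beyond n (I : {set 'I_n}) (x : nat) : nat := #|I :\: Lset n x|.

Lemma beyondS n (I : {set 'I_n}) (i : 'I_n) :
  beyond I i = ((i \in I) + beyond I i.+1)%N.
Proof.
rewrite /beyond (cardsD1 i) !inE ltnn /=; congr (_ + _)%N.
apply: eq_card => j; rewrite !inE -!leqNgt -val_eqE /=; lia.
Qed.

Lemma beyond_sub n (I J : {set 'I_n}) x : I \subset J -> (beyond I x <= beyond J x)%N.
Proof. by move=> IJ; apply: subset_leq_card; exact: setSD. Qed.

Lemma beyond_le n (I : {set 'I_n}) x x' : (x <= x' <= n)%N ->
  (beyond I x' <= beyond I x <= beyond I x' + (x' - x))%N.
Proof.
case/andP=> /subnKC <-; elim: (x' - x)%N => [|d IH] h.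
  by rewrite addn0 subnn addn0 leqnn.
have dn : (x + d < n)%N by lia.
have := beyondS I (Ordinal dn); rewrite /= => E.
have := IH (ltnW dn); rewrite E addnS; case: (_ \in _) => /=; lia.
Qed.

Lemma beyondD n (I J : {set 'I_n}) x : I \subset J ->
  (beyond J x = beyond I x + beyond (J :\: I) x)%N.
Proof.
move=> IJ; rewrite /beyond -(cardsID I (J :\: _)); congr (_ + _)%N.
  apply: eq_card => i; rewrite !inE; have := subsetP IJ i.
  by case: (i \in I) => [->|] //; rewrite ?andbT ?andbF.
by apply: eq_card => i; rewrite !inE; case: (i \in I); rewrite ?andbF ?andbT.
Qed.

Lemma beyond_le_card n (I : {set 'I_n}) x : (beyond I x <= #|I|)%N.
Proof. exact/subset_leq_card/subsetDl. Qed.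

Section Words.
Variable n : nat.
Implicit Types (I J : {set 'I_n}) (Q : seq 'I_n.-1).

Lemma here_neq_up (a : 'I_n.-1) : here a != up a.
Proof. by rewrite -val_eqE /=; lia. Qed.

Lemma card_cplus a I : #|cplus a I| = #|I|.
Proof.
rewrite /cplus; case: ifP => // /andP[hI uI].
by rewrite cardsU1 !inE (negbTE uI) andbF /= [in RHS](cardsD1 (here a)) hI.
Qed.

Lemma in_cplus a I i : (i \in cplus a I) =
  if i == up a then (here a \in I) || (up a \in I)
  else if i == here a then (here a \in I) && (up a \in I) else i \in I.
Proof.
have /negbTE hu := here_neq_up a; rewrite /cplus.
case: (eqVneq i (up a)) => [->|iu]; last case: (eqVneq i (here a)) => [->|ih];
case: (boolP (here a \in I)) => hI; case: (boolP (up a \in I)) => uI;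
rewrite /= ?inE ?hu ?eqxx ?(negbTE iu) ?(negbTE ih) ?hI ?uI ?(negbTE hI) ?(negbTE uI) //=.
Qed.

Lemma cplus_sub a I J : I \subset J -> cplus a I \subset cplus a J.
Proof.
move=> /subsetP IJ; apply/subsetP => i; rewrite !in_cplus.
case: ifP => _; first by case/orP=> /IJ ->; rewrite ?orbT.
by case: ifP => _; [case/andP=> /IJ -> /IJ -> | exact: IJ].
Qed.

Lemma pass_sub Q I J : I \subset J -> pass Q I \subset pass Q J.
Proof. by elim: Q I J => [|a Q IH] I J //= IJ; apply/IH/cplus_sub. Qed.

Lemma card_pass Q I : #|pass Q I| = #|I|.
Proof. by elim: Q I => [|a Q IH] I //=; rewrite IH card_cplus. Qed.

Lemma pass_Rset Q k : pass Q (Rset n k) = Rset n k.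
Proof.
elim: Q => [|a Q IH] //=; suff -> : cplus a (Rset n k) = Rset n k by [].
by apply/setP => i; rewrite in_cplus; do 2?case: eqP => [->|_] //; rewrite !inE /=; lia.
Qed.

(** The letter a moves an element into position a + 1 exactly when a is occupied and
a + 1 is free, that is, when the count drops from a to a + 1 but not from a + 1 to
a + 2; the minimum expresses this without case distinction. *)
Lemma beyond_cplus a I x : beyond (cplus a I) x =
  if x == a.+1 then minn (beyond I a.+1).+1 (minn (beyond I a) (beyond I a.+2).+1)
  else beyond I x.
Proof.
have B J i (hi : (i < n)%N) := beyondS J (Ordinal hi).
have an : (a < n)%N by have := ltn_ord a; lia.
have a1n : (a.+1 < n)%N by have := ltn_ord a; lia.
have Bh J : beyond J a = ((here a \in J) + beyond J a.+1)%N by exact: (beyondS J (here a)).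
have Bu J : beyond J a.+1 = ((up a \in J) + beyond J a.+2)%N by exact: (beyondS J (up a)).
have same y : y != a.+1 -> beyond (cplus a I) y = beyond I y.
  move=> ya; have [ay|ay] := ltnP a y.
    rewrite /beyond; apply: eq_card => i; rewrite inE [RHS]inE !in_Lset in_cplus.
    by do 2?case: eqP => [->|_] //=; rewrite (_ : (_ < y)%N = true) //; lia.
  have := card_cplus a I; rewrite -(cardsID (Lset n y) (cplus a I)) -(cardsID (Lset n y) I).
  suff -> : #|cplus a I :&: Lset n y| = #|I :&: Lset n y| by move/addnI.
  apply: eq_card => i; rewrite inE [RHS]inE !in_Lset in_cplus.
  by do 2?case: eqP => [->|_] //=; rewrite (_ : (_ < y)%N = false) ?andbF //; lia.
case: eqP => [->|/eqP]; last exact: same.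
have := Bu (cplus a I); rewrite (same a.+2) ?in_cplus ?eqxx; last by lia.
have := Bh I; have := Bu I.
case: (here a \in I); case: (up a \in I) => /=; lia.
Qed.

Definition flux Q (y x : nat) : nat := beyond (pass Q (Lset n y)) x.

(** I lies in the union of the first y positions and the part of I beyond y; adding
that part to the initial segment adds at most as many elements to its image. *)
Lemma beyond_pass_le Q I x y : (y <= n)%N ->
  (beyond (pass Q I) x <= beyond I y + flux Q y x)%N.
Proof.
move=> yn; set J := Lset n y :|: I.
apply: (@leq_trans (beyond (pass Q J) x)); first exact/beyond_sub/pass_sub/subsetUr.
have sLJ : pass Q (Lset n y) \subset pass Q J by exact/pass_sub/subsetUl.
rewrite (beyondD _ sLJ) addnC leq_add2r; apply: leq_trans (beyond_le_card _ _) _.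
rewrite cardsDS // !card_pass -cardsDS ?subsetUl // /beyond.
by apply: subset_leq_card; rewrite /J setDUl setDv set0U.
Qed.

(** By induction on the last letter: it changes the count at one position only, to a
minimum of three old values, and the same minimum bounds the flux from above. *)
Lemma beyond_pass_ge Q I x : (x <= n)%N -> exists2 y, (y <= n)%N &
  (beyond I y + flux Q y x <= beyond (pass Q I) x)%N.
Proof.
rewrite /flux /pass; elim/last_ind: Q x => [|Q a IH] x xn.
  by exists x; rewrite //= {2}/beyond setDv cards0 addn0.
rewrite foldl_rcons beyond_cplus.
have an := ltn_ord a.
have F y := foldl_rcons (fun J a => cplus a J) (Lset n y) Q a.
case: ifP => [/eqP xa|xa]; last first.
  by have [y yn H] := IH x xn; exists y; rewrite // F beyond_cplus xa.
pose c := beyond (foldl (fun J b => cplus b J) I Q).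
have [y1 yn1 H1] := IH a.+1 ltac:(lia).
have [y2 yn2 H2] := IH a ltac:(lia).
have [y3 yn3 H3] := IH a.+2 ltac:(lia).
have [|] := leqP (c a.+1).+1 (minn (c a) (c a.+2).+1) => m1.
  exists y1 => //; rewrite F beyond_cplus xa eqxx; rewrite -!/(c _) in H1 m1 *; lia.
have [|] := leqP (c a) (c a.+2).+1 => m2.
  exists y2 => //; rewrite F beyond_cplus xa eqxx; rewrite -!/(c _) in H2 m1 *; lia.
exists y3 => //; rewrite F beyond_cplus xa eqxx; rewrite -!/(c _) in H3 m1 *; lia.
Qed.

(** Since passes respect inclusion, the images of the initial segments form a
complete flag of sets and so encode a permutation. *)
Lemma corner_count_flux Q : corner_count n (flux Q).
Proof.
have sub y y' : (y <= y')%N -> pass Q (Lset n y) \subset pass Q (Lset n y').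
  by move=> yy; apply/pass_sub/Lset_sub.
split.
- move=> y x yn xn; have := card_pass Q (Lset n y).
  rewrite card_Lset // -(cardsID (Lset n x)) => {1}<-; rewrite leq_add2r.
  by rewrite -[leqRHS](card_Lset xn) subset_leq_card // subsetIr.
- move=> y y' x /andP[yy y'n] xn; rewrite /flux (beyondD x (sub _ _ yy)) leq_addr leq_add2l /=.
  apply: leq_trans (beyond_le_card _ _) _.
  by rewrite cardsDS ?sub // !card_pass !card_Lset // (leq_trans yy).
- by move=> y x x' yn xx; apply: beyond_le.
- move=> y y' x x' /andP[yy y'n] xx; rewrite /flux !(beyondD _ (sub _ _ yy)).
  by have /andP[] := beyond_le (pass Q (Lset n y') :\: pass Q (Lset n y)) xx; lia.
Qed.

Lemma eq_Rset I k : (k <= n)%N -> #|I| = k -> (k <= beyond I (n - k))%N -> I = Rset n k.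
Proof.
move=> kn cI h; have : I :\: Lset n (n - k) == I.
  by rewrite eqEcard subsetDl cI.
rewrite Rset_setC => /eqP E; apply/eqP; rewrite eqEcard cI card_LsetC ?leq_subr // subKn // leqnn andbT.
by rewrite -E setDE subsetIr.
Qed.

Lemma beyond_Rset k : (k <= n)%N -> beyond (Rset n k) (n - k) = k.
Proof. by move=> kn; rewrite /beyond Rset_setC setDE setIid card_LsetC ?leq_subr ?subKn. Qed.

Lemma pass_time_step Q k : (3 <= k)%N -> (k + 4 <= n)%N ->
  leqoo (pass_time k Q) 2 -> leqoo (pass_time (k + 2) Q) 3.
Proof.
move=> k3 k4 /leqoo_least_pos [m [m2 Pm]]; apply/leqoo_least_pos; exists 3%N; split => //.
have {m m2 Pm} P2 : pass Q (pass Q (Lset n k)) = Rset n k.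
  by case: m m2 Pm => [|[|[|m]]] //= _ -> //; rewrite pass_Rset.
have hyp z : (z <= n)%N -> (k <= flux Q k z + flux Q z (n - k))%N.
  by move=> zn; have := beyond_pass_le Q (pass Q (Lset n k)) (n - k) zn; rewrite P2 beyond_Rset //; lia.
apply: eq_Rset; first by lia.
  by rewrite /= !card_pass card_Lset; lia.
have [z zn] := beyond_pass_ge Q (pass Q (pass Q (Lset n (k + 2)))) (leq_subr (k + 2) n).
have [z' z'n] := beyond_pass_ge Q (pass Q (Lset n (k + 2))) zn.
have := two_to_three_steps (corner_count_flux Q) k3 k4 hyp z'n zn.
rewrite /= {1}/flux; lia.
Qed.

End Words.

(** * The Desnanot-Jacobi identity *)

Section Desnanot.
Variable R : comNzRingType.

(** Column q is replaced by the unit vector of p, so that the determinant is the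
cofactor at (p, q). *)
Definition put_col n (M : 'M[R]_n) (q p : 'I_n) : 'M[R]_n :=
  \matrix_(i, j) if j == q then (i == p)%:R else M i j.

Lemma det_put_col n (M : 'M[R]_n) q p : \det (put_col M q p) = cofactor M p q.
Proof.
rewrite (expand_det_col _ q) (bigD1 p) //= big1 => [|i ip].
  rewrite mxE !eqxx mul1r addr0 /cofactor; congr (_ * \det _).
  by apply/matrixP => i j; rewrite !mxE eq_sym (negbTE (neq_lift _ _)).
by rewrite mxE eqxx (negbTE ip) mul0r.
Qed.

(** The cofactors c of the modified matrix along column q' annihilate all columns of M
other than q and q'.  So c M has at most two nonzero entries, and multiplying by
the adjugate of M gives the identity, also when M is singular. *)
Lemma cramer_put_col n (M : 'M[R]_n) q p p' q' : q != q' ->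
  \det M * cofactor (put_col M q p) p' q' =
  cofactor M p q * cofactor M p' q' - cofactor M p q' * cofactor M p' q.
Proof.
move=> qq; set M1 := put_col M q p.
have E j : \sum_i M i j * cofactor M1 i q' =
    (j == q')%:R * cofactor M p q - (j == q)%:R * cofactor M p q'.
  have [->|jq] := eqVneq j q.
    rewrite (negbTE qq) mul0r sub0r mul1r -!det_put_col.
    set W := put_col M q' p.
    have -> : \sum_i M i q * cofactor M1 i q' = \det (xcol q q' W).
      rewrite (expand_det_col _ q'); apply: eq_bigr => i _.
      rewrite !mxE tpermR (negbTE qq); congr (_ * (_ * \det _)).
      apply/matrixP => i' l; rewrite !mxE.
      case: tpermP => [->|lq'|/eqP lq /eqP lq']; rewrite ?eqxx //.
        by have := neq_lift q' l; rewrite lq' eqxx.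
      by rewrite (negbTE lq) (negbTE lq').
    by rewrite xcolE det_mulmx det_perm odd_tperm qq expr1 mulrN1.
  rewrite mul0r subr0.
  have := congr1 (fun X : 'M_n => X q' j) (mul_adj_mx M1).
  rewrite !mxE -det_put_col -/M1 mulr_natl (eq_sym j) => <-.
  apply: eq_bigr => i _; rewrite !mxE (negbTE jq) mulrC //.
have -> : \det M * cofactor M1 p' q' =
    \sum_j cofactor M p' j * \sum_i M i j * cofactor M1 i q'.
  have -> : \det M * cofactor M1 p' q' = \sum_i (M *m \adj M) i p' * cofactor M1 i q'.
    rewrite mul_mx_adj (bigD1 p') //= big1 => [|i ip]; first by rewrite addr0 mxE eqxx.
    by rewrite mxE (negbTE ip) mul0r.
  under eq_bigr do rewrite mxE mulr_suml.
  rewrite exchange_big /=; apply: eq_bigr => j _; rewrite mulr_sumr.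
  by apply: eq_bigr => i _; rewrite mxE; ring.
under eq_bigr do rewrite E mulrBr.
rewrite big_split /= sumrN; congr (_ - _).
  rewrite (bigD1 q') //= big1 => [|j /negbTE ->]; last by rewrite mul0r mulr0.
  by rewrite eqxx mul1r addr0 mulrC.
rewrite (bigD1 q) //= big1 => [|j /negbTE ->]; last by rewrite mul0r mulr0.
by rewrite eqxx mul1r addr0 mulrC.
Qed.

(** Removing row p' and column q' first and then p0 and q0 from what is left removes
the rows p, p' and the columns q, q'; the order conditions make all the cofactor
signs cancel. *)
Lemma desnanot n (M : 'M[R]_n.+2) (p' q' : 'I_n.+2) (p0 q0 : 'I_n.+1) :
  (p0 < p')%N -> (q0 < q')%N -> let p := lift p' p0 in let q := lift q' q0 in
  \det M * \det (row' p0 (col' q0 (row' p' (col' q' M)))) =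
  \det (row' p (col' q M)) * \det (row' p' (col' q' M)) -
  \det (row' p (col' q' M)) * \det (row' p' (col' q M)).
Proof.
move=> pp qq p q.
have qq' : q != q' by rewrite eq_sym neq_lift.
have vp : p = p0 :> nat by rewrite /= /bump leqNgt pp.
have vq : q = q0 :> nat by rewrite /= /bump leqNgt qq.
have := cramer_put_col M p p' qq'.
have -> : cofactor (put_col M q p) p' q' =
    (-1) ^+ (p' + q') * cofactor (row' p' (col' q' M)) p0 q0.
  rewrite /cofactor; congr (_ * _); rewrite -[RHS]/(cofactor _ p0 q0) -det_put_col.
  congr (\det _); apply/matrixP => i j; rewrite !mxE.
  by rewrite !(inj_eq lift_inj).
rewrite /cofactor vp vq !exprD.
set u := (-1) ^+ p0; set v := (-1) ^+ q0; set s := (-1) ^+ p'; set t := (-1) ^+ q'.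
move=> E; have w1 : (u * v * s * t) * (u * v * s * t) = 1 by rewrite -!exprD -signr_odd addnn odd_double.
rewrite -[LHS]mul1r -[RHS]mul1r -w1 -!mulrA -/p -/q; do 4!congr (_ * _).
move: E; rewrite !mulrBr => E.
by rewrite [LHS](_ : _ =
  \det M * (s * t * (u * v * \det (row' p0 (col' q0 (row' p' (col' q' M))))))); [rewrite E|]; ring.
Qed.
End Desnanot.

(** * Minors along increasing maps *)

Definition increasing m n (f : 'I_m -> 'I_n) := forall i j : 'I_m, (i < j)%N -> (f i < f j)%N.

Lemma increasing_inj m n (f : 'I_m -> 'I_n) : increasing f -> injective f.
Proof.
move=> inc i j fij; apply/val_inj/eqP; rewrite eqn_leq.
by apply/andP; split; rewrite leqNgt; apply/negP => /inc; rewrite fij ltnn.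
Qed.

Lemma sorted_enum_set n (I : {set 'I_n}) : sorted (fun i j : 'I_n => i < j)%N (enum I).
Proof.
rewrite /enum_mem; apply: sorted_filter; first by move=> i j l; apply: ltn_trans.
by rewrite -enumT; have := iota_ltn_sorted 0 n; rewrite -val_enum_ord sorted_map.
Qed.

Lemma increasing_enum_val n (I : {set 'I_n}) k (e : k = #|I|) :
  increasing (fun i => enum_val (cast_ord e i)).
Proof.
move=> i j ij; have n0 : 'I_n by exact: enum_val (cast_ord e i).
rewrite !(enum_val_nth n0).
have tr : transitive (fun i j : 'I_n => i < j)%N by move=> ? ? ?; apply: ltn_trans.
apply: (sorted_ltn_nth tr _ (sorted_enum_set I)) => //; rewrite inE -cardE; exact: ltn_ord.
Qed.

Lemma image_enum_val n (I : {set 'I_n}) k (e : k = #|I|) :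
  [set enum_val (cast_ord e i) | i in setT] = I.
Proof.
apply/setP => x; apply/imsetP/idP => [[i _ ->]|xI]; first exact: enum_valP.
exists (cast_ord (esym e) (enum_rank_in xI x)); rewrite ?inE // cast_ordKV.
by rewrite enum_rankK_in.
Qed.

Lemma increasing_onto n (I : {set 'I_n}) k : #|I| = k ->
  exists2 f : 'I_k -> 'I_n, increasing f & f @: setT = I.
Proof.
by move=> /esym e; exists (fun i => enum_val (cast_ord e i));
  [exact: increasing_enum_val | exact: image_enum_val].
Qed.

Lemma card_image_ord n k (f : 'I_k -> 'I_n) : injective f -> #|f @: setT| = k.
Proof. by move=> fi; rewrite card_imset // cardsT card_ord. Qed.

Lemma increasing_unique n k (f g : 'I_k -> 'I_n) : increasing f -> increasing g ->
  f @: setT = g @: setT -> f =1 g.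
Proof.
move=> fi gi fg.
have tr : transitive (fun i j : 'I_n => i < j)%N by move=> ? ? ?; apply: ltn_trans.
have ir : irreflexive (fun i j : 'I_n => i < j)%N by move=> ?; rewrite ltnn.
have so h : increasing h -> sorted (fun i j : 'I_n => i < j)%N [seq h i | i <- enum 'I_k].
  move=> hi; apply: (homo_sorted hi).
  by have := iota_ltn_sorted 0 k; rewrite -val_enum_ord sorted_map.
have me h x : (x \in [seq h i | i <- enum 'I_k]) = (x \in h @: setT).
  by apply/mapP/imsetP => -[i _ ->]; exists i; rewrite ?mem_enum ?inE.
have /(irr_sorted_eq tr ir (so f fi) (so g gi)) E:
    [seq f i | i <- enum 'I_k] =i [seq g i | i <- enum 'I_k].
  by move=> x; rewrite !me fg.
by move=> i; have /eq_in_map -> := E; rewrite ?mem_enum.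
Qed.

Section MinorTheory.
Variable R : realType.

(** This frees computations with minors from the enumerations and dimension casts
in their definition. *)
Lemma minor_increasing m n k (B : 'M[R]_(m, n)) (f : 'I_k -> 'I_m) (g : 'I_k -> 'I_n) :
  increasing f -> increasing g ->
  minor B (f @: setT) (g @: setT) = \det (mxsub f g B).
Proof.
move=> fi gi; rewrite /minor.
have e1 := esym (card_image_ord (increasing_inj fi)).
have e2 := esym (card_image_ord (increasing_inj gi)).
have /= E1 := increasing_unique (increasing_enum_val e1) fi (image_enum_val e1).
have /= E2 := increasing_unique (increasing_enum_val e2) gi (image_enum_val e2).
have gen m' n' (c1 : k = m') (c2 : k = n') (X : 'M[R]_(m', n')) :
  \det (conform_mx (0 : 'M_m') X) = \det (\matrix_(i, j) X (cast_ord c1 i) (cast_ord c2 j)).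
  subst m' n'; rewrite conform_mx_id; congr (\det _).
  by apply/matrixP => i j; rewrite mxE !cast_ord_id.
rewrite (gen _ _ e1 e2); congr (\det _); apply/matrixP => i j.
by rewrite !mxE E1 E2.
Qed.

Lemma increasing_lift n k (f : 'I_k.+1 -> 'I_n) p : increasing f ->
  increasing (f \o lift p) /\ (f \o lift p) @: setT = f @: setT :\ f p.
Proof.
move=> fi; split=> [i j ij|]; first apply: fi.
  by move: ij; rewrite /= /bump; do 2!case: leqP => /= *; lia.
apply/setP => x; apply/imsetP/idP => [[i _ ->]|].
  rewrite !inE /= imset_f ?inE // andbT (inj_eq (increasing_inj fi)).
  by rewrite eq_sym neq_lift.
rewrite !inE => /andP[xp /imsetP[i _ xi]]; case: (unliftP p i) => [j ij|ip].
  by exists j; rewrite ?inE //= -ij.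
by rewrite xi ip eqxx in xp.
Qed.

Lemma minor_desnanot m n (B : 'M[R]_(m, n)) (U : {set 'I_m}) (V : {set 'I_n})
    (a b : 'I_m) (c d : 'I_n) :
  #|U| = #|V| -> a \in U -> b \in U -> (a < b)%N -> c \in V -> d \in V -> (c < d)%N ->
  minor B U V * minor B (U :\ a :\ b) (V :\ c :\ d) =
  minor B (U :\ a) (V :\ c) * minor B (U :\ b) (V :\ d) -
  minor B (U :\ a) (V :\ d) * minor B (U :\ b) (V :\ c).
Proof.
move=> UV aU bU ab cV dV cd.
have [k Uk] : exists k, #|U| = k.+2.
  exists (#|U| - 2)%N; rewrite (cardsD1 b) bU (cardsD1 a) !inE aU /=.
  by rewrite -(inj_eq val_inj) /= neq_ltn ab; lia.
have [f fi fU] := increasing_onto Uk; have Vk := etrans (esym UV) Uk.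
have [g gi gV] := increasing_onto Vk.
have pos l o (h : 'I_l.+2 -> 'I_o) x y : increasing h -> x \in h @: setT -> y \in h @: setT ->
  (x < y)%N -> exists (i0 : 'I_l.+1) (i' : 'I_l.+2), [/\ (i0 < i')%N, h i' = y & h (lift i' i0) = x].
  move=> hi /imsetP[i _ ->] /imsetP[j _ ->] hij.
  case: (unliftP j i) => [i0 E|E]; last by rewrite E ltnn in hij.
  exists i0, j; rewrite -E; split => //; rewrite ltnNge; apply/negP => ji.
  have : (j < i)%N by rewrite E /= /bump ji.
  by move/hi; lia.
have := pos _ _ f a b fi; rewrite fU => /(_ aU bU ab) [p0 [p' [pp pb pa]]].
have := pos _ _ g c d gi; rewrite gV => /(_ cV dV cd) [q0 [q' [qq qd qc]]].
have rE k1 k2 (h1 : 'I_k1.+1 -> 'I_m) (h2 : 'I_k2.+1 -> 'I_n) i j :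
  row' i (col' j (mxsub h1 h2 B)) = mxsub (h1 \o lift i) (h2 \o lift j) B.
  by apply/matrixP => ? ?; rewrite !mxE.
have := desnanot (mxsub f g B) pp qq; rewrite /= !rE.
have [fb fbE] := increasing_lift p' fi; have [gd gdE] := increasing_lift q' gi.
have [fa faE] := increasing_lift (lift p' p0) fi.
have [gc gcE] := increasing_lift (lift q' q0) gi.
have [fab fabE] := increasing_lift p0 fb; have [gcd gcdE] := increasing_lift q0 gd.
rewrite -!minor_increasing // faE gcE fabE gcdE fbE gdE fU gV /= pb pa qc qd.
by rewrite !(setDDl _ [set a]) !(setDDl _ [set c]) (setUC [set a]) (setUC [set c]) -!setDDl.
Qed.
End MinorTheory.

(** * The Cauchy-Binet expansion *)

Section CauchyBinet.

(** The usual formula sums over increasing maps only.  Summing over all maps counts each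
of them k! times, because reordering the values of f changes both determinants by the
same sign; this symmetric form has a shorter proof and is as good for deciding
positivity. *)
Lemma cauchy_binet_ffun (S : comNzRingType) k n (A : 'M[S]_(k, n)) (B : 'M[S]_(n, k)) :
  (k`!)%:R * \det (A *m B) =
  \sum_(f : {ffun 'I_k -> 'I_n}) \det (colsub f A) * \det (rowsub f B).
Proof.
have E1 : \det (A *m B) = \sum_(f : {ffun 'I_k -> 'I_n}) (\prod_i A i (f i)) * \det (rowsub f B).
  rewrite /determinant; under [RHS]eq_bigr do rewrite mulr_sumr.
  rewrite exchange_big /=; apply: eq_bigr => s _.
  under eq_bigr do rewrite mxE.
  rewrite bigA_distr_bigA mulr_sumr; apply: eq_bigr => f _.
  rewrite mulrCA; congr (_ * _); rewrite -big_split /=; apply: eq_bigr => i _.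
  by rewrite !mxE.
under eq_bigr do rewrite {1}/determinant mulr_suml.
rewrite exchange_big /= (eq_bigr (fun=> \det (A *m B))) => [|s _].
  by rewrite sumr_const card_Sn mulr_natl.
rewrite E1 (reindex_inj (h := fun f : {ffun 'I_k -> 'I_n} => [ffun i => f (s^-1%g i)])) /=; last first.
  move=> f g /ffunP fg; apply/ffunP => i.
  by have := fg (s i); rewrite !ffunE permK.
apply: eq_bigr => f _.
have -> : \det (rowsub [ffun i => f (s^-1%g i)] B) = (-1) ^+ s * \det (rowsub f B).
  rewrite -(odd_permV s) -det_perm -det_mulmx; congr (\det _).
  by rewrite -row_permE; apply/matrixP => i j; rewrite !mxE ffunE.
rewrite mulrACA -signr_addb addbb mul1r; congr (_ * _).
by apply: eq_bigr => i _; rewrite !mxE ffunE permK.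
Qed.

Variable R : realType.

(** Sorting the values of h multiplies both determinants by the same sign. *)
Lemma minor_mul_perm m n p k (B : 'M[R]_(m, n)) (C : 'M[R]_(n, p))
    (f : 'I_k -> 'I_m) (g : 'I_k -> 'I_p) (h : 'I_k -> 'I_n) :
  increasing f -> increasing g -> injective h ->
  \det (mxsub f h B) * \det (mxsub h g C) =
  minor B (f @: setT) (h @: setT) * minor C (h @: setT) (g @: setT).
Proof.
move=> fi gi hi; have [h0 h0i h0E] := increasing_onto (card_image_ord hi).
have /fin_all_exists [s hs] i : exists j, h i = h0 j.
  by have : h i \in h0 @: setT; [rewrite h0E imset_f | case/imsetP => j _; exists j].
have si : injective s by move=> i j sij; apply: hi; rewrite !hs sij.
rewrite -{1 2}h0E !minor_increasing //; pose t := perm si.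
have -> : mxsub f h B = col_perm t (mxsub f h0 B).
  by apply/matrixP => i j; rewrite !mxE permE -hs.
have -> : mxsub h g C = row_perm t (mxsub h0 g C).
  by apply/matrixP => i j; rewrite !mxE permE -hs.
rewrite row_permE col_permE !det_mulmx !det_perm odd_permV -!mulrA; congr (_ * _).
by rewrite mulrA -signr_addb addbb mul1r.
Qed.

Lemma minor_mulmx m n p k (B : 'M[R]_(m, n)) (C : 'M[R]_(n, p))
    (I : {set 'I_m}) (J : {set 'I_p}) :
  #|I| = k -> #|J| = k ->
  (k`!)%:R * minor (B *m C) I J =
  \sum_(h : {ffun 'I_k -> 'I_n} | injectiveb h)
    minor B I (h @: setT) * minor C (h @: setT) J.
Proof.
move=> /increasing_onto [f fi <-] /increasing_onto [g gi <-].
have -> : minor (B *m C) (f @: setT) (g @: setT) = \det (rowsub f B *m colsub g C).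
  rewrite minor_increasing //; congr (\det _).
  by apply/matrixP => i j; rewrite !mxE; apply: eq_bigr => l _; rewrite !mxE.
rewrite cauchy_binet_ffun (bigID (fun h : {ffun _ -> _} => injectiveb h)) /= [X in _ + X]big1 ?addr0.
  apply: eq_bigr => h /injectiveP hi.
  by rewrite -(minor_mul_perm B C fi gi hi) -mxsubcr -mxsubrc.
move=> h /injectivePn [x [y xy hxy]]; rewrite (_ : \det _ = 0) ?mul0r //.
rewrite -det_tr; apply: (determinant_alternate xy) => i; rewrite !mxE hxy //.
Qed.

Lemma totally_nonnegative_mul m n p (B : 'M[R]_(m, n)) (C : 'M[R]_(n, p)) :
  totally_nonnegative B -> totally_nonnegative C -> totally_nonnegative (B *m C).
Proof.
move=> Bt Ct I J IJ; rewrite -(pmulr_rge0 _ (_ : 0 < (#|I|`!)%:R)) ?ltr0n ?fact_gt0 //.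
rewrite (minor_mulmx _ _ (erefl #|I|)) //; apply: sumr_ge0 => h /injectiveP hi.
by rewrite mulr_ge0 ?Bt ?Ct // card_image_ord.
Qed.

Lemma minor_mul_gt0 m n p (B : 'M[R]_(m, n)) (C : 'M[R]_(n, p))
    (I : {set 'I_m}) (K : {set 'I_n}) (J : {set 'I_p}) :
  totally_nonnegative B -> totally_nonnegative C -> #|I| = #|K| -> #|K| = #|J| ->
  0 < minor B I K -> 0 < minor C K J -> 0 < minor (B *m C) I J.
Proof.
move=> Bt Ct IK KJ Bp Cp; have IJ := etrans IK KJ.
rewrite -(pmulr_rgt0 _ (_ : 0 < (#|I|`!)%:R)) ?ltr0n ?fact_gt0 //.
rewrite (minor_mulmx _ _ (erefl #|I|)) //.
have [h hi hK] := increasing_onto (esym IK).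
have hI : injectiveb (finfun h).
  by apply/injectiveP => i j; rewrite !ffunE => /(increasing_inj hi).
have E : finfun h @: setT = K by rewrite -hK; apply: eq_imset => i; rewrite ffunE.
rewrite (bigD1 (finfun h)) //= E ltr_wpDr ?mulr_gt0 //.
apply: sumr_ge0 => f /andP[/injectiveP fi _].
by rewrite mulr_ge0 ?Bt ?Ct // card_image_ord.
Qed.

Lemma minor_tr m n (B : 'M[R]_(m, n)) (I : {set 'I_m}) (J : {set 'I_n}) :
  #|I| = #|J| -> minor B^T J I = minor B I J.
Proof.
move=> IJ; have [f fi fI] := increasing_onto (erefl #|I|).
have [g gi gJ] := increasing_onto (esym IJ).
by rewrite -fI -gJ !minor_increasing // -trmx_mxsub det_tr.
Qed.

Lemma totally_nonnegative_tr m n (B : 'M[R]_(m, n)) :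
  totally_nonnegative B -> totally_nonnegative B^T.
Proof. by move=> Bt I J IJ; rewrite minor_tr // Bt. Qed.

Lemma minor_setT n (B : 'M[R]_n) : minor B setT setT = \det B.
Proof.
have idi : increasing (@id 'I_n) by [].
by rewrite -{1 2}(imset_id [set: 'I_n]) minor_increasing // mxsub_id.
Qed.

End CauchyBinet.

(** * Ranks of submatrices *)

Section CornerRank.
Variable R : realType.

Definition mask n (I : {set 'I_n}) : 'M[R]_n := diag_mx (\row_i (i \in I)%:R).

Definition rk m n (B : 'M[R]_(m, n)) (I : {set 'I_m}) (J : {set 'I_n}) : nat :=
  \rank (mask I *m B *m mask J).

Lemma mask_mul n (I J : {set 'I_n}) : mask I *m mask J = mask (I :&: J).
Proof.
rewrite mulmx_diag; congr diag_mx; apply/rowP => i.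
by rewrite !mxE inE -natrM mulnb.
Qed.

Lemma mask_setD n (I J : {set 'I_n}) : J \subset I -> mask I = mask J + mask (I :\: J).
Proof.
move=> /subsetP JI; rewrite -raddfD; congr diag_mx; apply/rowP => i.
rewrite !mxE !inE -natrD; congr (_%:R); have := JI i.
by case: (i \in J) => [->|_].
Qed.

Lemma mask_setT n : mask [set: 'I_n] = 1%:M.
Proof. by apply/matrixP => i j; rewrite !mxE inE. Qed.

Lemma tr_mask n (I : {set 'I_n}) : (mask I)^T = mask I.
Proof. exact: tr_diag_mx. Qed.

Definition select n (I : {set 'I_n}) : 'M[R]_(#|I|, n) := rowsub enum_val 1%:M.

Lemma select_mul_tr n (I : {set 'I_n}) : select I *m (select I)^T = 1%:M.
Proof.
rewrite /select trmx_mxsub trmx1 -mxsub_mul mul1mx; apply/matrixP => i j.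
by rewrite !mxE (inj_eq enum_val_inj).
Qed.

Lemma tr_select_mul n (I : {set 'I_n}) : (select I)^T *m select I = mask I.
Proof.
apply/matrixP => i j; rewrite !mxE.
have [iI|iI] := boolP (i \in I).
  rewrite (bigD1 (enum_rank_in iI i)) //= big1 => [|l li].
    by rewrite !mxE enum_rankK_in // eqxx mul1r addr0; case: eqP.
  rewrite !mxE (_ : (enum_val l == i) = false) ?mul0r //.
  apply: contraNF li => /eqP E; apply/eqP/enum_val_inj.
  by rewrite enum_rankK_in // E.
rewrite mul0rn big1 // => l _; rewrite !mxE (_ : (enum_val l == i) = false) ?mul0r //.
by apply: contraNF iI => /eqP <-; apply: enum_valP.
Qed.

Lemma rank_mask n (I : {set 'I_n}) : \rank (mask I) = #|I|.
Proof.
apply/eqP; rewrite eqn_leq -tr_select_mul; apply/andP; split.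
  by apply: leq_trans (mxrankM_maxl _ _) _; rewrite rank_leq_col.
rewrite -{1}(mxrank1 R #|I|) -(mulmx1 1%:M) -{2}(select_mul_tr I) -{1}(select_mul_tr I).
rewrite -mulmxA (mulmxA _^T); apply: leq_trans (mxrankM_maxr _ _) (mxrankM_maxl _ _).
Qed.

Lemma select_mask n (I : {set 'I_n}) : select I *m mask I = select I.
Proof. by rewrite -tr_select_mul mulmxA select_mul_tr mul1mx. Qed.

(** Masking by diagonal 0-1 matrices keeps the dimensions fixed, so that ranks of
different submatrices can be compared by matrix identities. *)
Lemma rkE m n (B : 'M[R]_(m, n)) I J : rk B I J = \rank (submx_set B I J).
Proof.
have -> : submx_set B I J = select I *m B *m (select J)^T.
  rewrite /select trmx_mxsub trmx1 mul_rowsub_mx mul1mx mulmx_colsub mulmx1.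
  by apply/matrixP => i j; rewrite !mxE.
rewrite /rk; apply/eqP; rewrite eqn_leq; apply/andP; split.
  rewrite -!tr_select_mul mulmxA -(mulmxA _ _ B) -(mulmxA _ (select I *m B)).
  by apply: leq_trans (mxrankM_maxl _ _) (mxrankM_maxr _ _).
rewrite -(select_mask I) -(select_mask J) trmx_mul tr_mask.
rewrite mulmxA -(mulmxA _ (mask I)) -(mulmxA _ (_ *m B)).
by apply: leq_trans (mxrankM_maxl _ _) (mxrankM_maxr _ _).
Qed.

Lemma minor_neq0 m n (B : 'M[R]_(m, n)) (I : {set 'I_m}) (J : {set 'I_n}) :
  #|I| = #|J| -> (minor B I J != 0) = (rk B I J == #|I|).
Proof.
rewrite rkE /minor; move: (submx_set B I J); move: #|J| => k X kE; subst k.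
by rewrite conform_mx_id -unitfE -unitmxE -row_free_unit.
Qed.

Lemma minor_gt0 m n (B : 'M[R]_(m, n)) (I : {set 'I_m}) (J : {set 'I_n}) :
  totally_nonnegative B -> #|I| = #|J| -> (0 < minor B I J) = (rk B I J == #|I|).
Proof. by move=> Bt IJ; rewrite lt0r Bt // andbT minor_neq0. Qed.

Section RankFunction.
Variables m n : nat.
Implicit Types (B : 'M[R]_(m, n)) (I K Y : {set 'I_m}) (J : {set 'I_n}).

Lemma rk_tr B I J : rk B^T J I = rk B I J.
Proof. by rewrite /rk -mxrank_tr !trmx_mul !tr_mask trmxK mulmxA. Qed.

Lemma rk_subset B I I' J J' : I \subset I' -> J \subset J' -> (rk B I J <= rk B I' J')%N.
Proof.
move=> /setIidPl II /setIidPl JJ; rewrite /rk -II -JJ -mask_mul setIC -mask_mul.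
rewrite mulmxA -(mulmxA (mask I)) -(mulmxA (mask I)).
by apply: leq_trans (mxrankM_maxl _ _) (mxrankM_maxr _ _).
Qed.

Lemma rk_le_card B I J : (rk B I J <= #|I|)%N.
Proof. by rewrite -rank_mask /rk -mulmxA mxrankM_maxl. Qed.

Lemma rk_rows B I I' J : I' \subset I -> (rk B I J <= rk B I' J + #|I :\: I'|)%N.
Proof.
move=> II; rewrite /rk (mask_setD II) !mulmxDl.
by apply: leq_trans (mxrank_add _ _) _; rewrite leq_add2l rk_le_card.
Qed.

(** Frobenius' rank inequality for the factors mask I, B restricted to I' and J',
and mask J. *)
Lemma rk_monge B I I' J J' : I \subset I' -> J \subset J' ->
  (rk B I J' + rk B I' J <= rk B I' J' + rk B I J)%N.
Proof.
move=> /setIidPl II /setIidPl JJ.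
have EI : mask I *m mask I' = mask I by rewrite mask_mul II.
have EJ : mask J' *m mask J = mask J by rewrite mask_mul setIC JJ.
have := mxrank_Frobenius (mask I) (mask I' *m B *m mask J') (mask J).
by rewrite !mulmxA EI -!(mulmxA _ (mask J') (mask J)) EJ.
Qed.

(** If no row of Y enlarges the independent set I, then all rows of Y lie in the span of
those of I. *)
Lemma rk_augment B I Y J : rk B I J = #|I| -> (#|I| < rk B Y J)%N ->
  exists i, [/\ i \in Y, i \notin I & rk B (i |: I) J = #|i |: I|].
Proof.
move=> rI rY; pose X := B *m mask J.
have rX K : rk B K J = \rank (mask K *m X) by rewrite /rk mulmxA.
have /row_subPn [i Hi] : ~~ (mask Y *m X <= mask I *m X)%MS.
  by apply: contraL rY => /mxrankS; rewrite -!rX rI -leqNgt.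
have rowX K j : row j (mask K *m X) = (j \in K)%:R *: row j X.
  by apply/rowP => c; rewrite mul_diag_mx !mxE.
have iY : i \in Y by apply: contraR Hi => /negbTE iY; rewrite rowX iY scale0r sub0mx.
have iI : i \notin I.
  apply: contraNN Hi => iI; rewrite rowX iY.
  by have := row_sub i (mask I *m X); rewrite rowX iI.
exists i; split => //; apply/eqP; rewrite eqn_leq rk_le_card cardsU1 iI add1n.
rewrite -rI !rX; rewrite rowX iY scale1r in Hi.
have sub : (mask I *m X <= mask (i |: I) *m X)%MS.
  apply/row_subP => j; rewrite rowX.
  have := row_sub j (mask (i |: I) *m X); rewrite rowX !inE.
  by case: (j \in I); rewrite ?orbT // scale0r sub0mx.
rewrite ltn_neqAle mxrankS // andbT (mxrank_leqif_sup sub).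
apply: contraNN Hi => /(submx_trans _); apply.
by have := row_sub i (mask (i |: I) *m X); rewrite rowX !inE eqxx scale1r.
Qed.

Lemma rk_extend B I Y J : I \subset Y -> rk B I J = #|I| ->
  exists K, [/\ I \subset K, K \subset Y, #|K| = rk B Y J & rk B K J = #|K|].
Proof.
move=> IY rI; have [d Ed] : exists d, (rk B Y J <= #|I| + d)%N by exists (rk B Y J); rewrite leq_addl.
elim: d I IY rI Ed => [|d IH] I IY rI Ed.
  exists I; split=> //; apply/eqP; rewrite eqn_leq -{1}rI rk_subset //.
  by rewrite addn0 in Ed.
have [h|h] := leqP (rk B Y J) #|I|.
  exists I; split=> //; apply/eqP; rewrite eqn_leq -{1}rI rk_subset //.
have [i [iY iI ri]] := rk_augment rI h.
have [||K [IK KY cK rK]] := IH (i |: I) _ ri.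
- by rewrite subUset sub1set iY.
- by rewrite cardsU1 iI; lia.
by exists K; split=> //; apply: subset_trans IK; apply: subsetUr.
Qed.

End RankFunction.

Lemma rk_le_card_col m n (B : 'M[R]_(m, n)) I J : (rk B I J <= #|J|)%N.
Proof. by rewrite -rk_tr rk_le_card. Qed.

Lemma rk_unit_rows n (B : 'M[R]_n) I : B \in unitmx -> rk B I setT = #|I|.
Proof. by move=> Bu; rewrite /rk mask_setT mulmx1 mxrankMfree ?rank_mask ?row_free_unit. Qed.

Lemma rk_unit_cols n (B : 'M[R]_n) J : B \in unitmx -> rk B setT J = #|J|.
Proof. by move=> Bu; rewrite -rk_tr rk_unit_rows ?unitmx_tr. Qed.

(** Split the sum over the inner index of B C according to K. *)
Lemma rk_mulmx_le m n p (B : 'M[R]_(m, n)) (C : 'M[R]_(n, p)) I J K :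
  (rk (B *m C) I J <= rk B I (~: K) + rk C K J)%N.
Proof.
rewrite /rk -[B in B *m C]mulmx1 -mask_setT (mask_setD (subsetT K)).
rewrite mulmxDr addrC setTD mulmxDl mulmxDr mulmxDl.
apply: leq_trans (mxrank_add _ _) (leq_add _ _).
  by rewrite !mulmxA -mulmxA mxrankM_maxl.
by rewrite -!mulmxA (mulmxA (mask I)) (mulmxA (mask K)) mxrankM_maxr.
Qed.

Definition corner n (B : 'M[R]_n) (y x : nat) : nat := rk B (Lset n y) (~: Lset n x).

Lemma corner_count_corner n (B : 'M[R]_n) : B \in unitmx -> corner_count n (corner B).
Proof.
move=> Bu; split=> [y x yn xn|y y' x /andP[yy y'n] xn|y x x' yn /andP[xx x'n]|
                    y y' x x' /andP[yy _] /andP[xx _]].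
- rewrite -{1}(card_Lset yn) -(rk_unit_rows _ Bu) -rk_tr addnC.
  apply: leq_trans (rk_rows _ _ (subsetT (~: Lset n x))) _.
  by rewrite rk_tr setTD setCK card_Lset.
- rewrite rk_subset ?Lset_sub //=; apply: leq_trans (rk_rows _ _ (Lset_sub n yy)) _.
  by rewrite cardsDS ?Lset_sub // !card_Lset // (leq_trans yy).
- have sub : ~: Lset n x' \subset ~: Lset n x by rewrite setCS Lset_sub.
  rewrite rk_subset //= /corner -rk_tr; apply: leq_trans (rk_rows _ _ sub) _.
  rewrite rk_tr leq_add2l cardsDS // !card_LsetC //; lia.
- by rewrite [leqRHS]addnC; apply: rk_monge; rewrite ?setCS Lset_sub.
Qed.

Lemma corner_mulmx_le n (B C : 'M[R]_n) y z x :
  (corner (B *m C) y x <= corner B y z + corner C z x)%N.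
Proof. exact: rk_mulmx_le. Qed.

End CornerRank.

(** * Families of sets closed under moving elements down *)

Lemma belowS n (G : {set 'I_n}) (i : 'I_n) :
  #|G :&: Lset n i.+1| = (#|G :&: Lset n i| + (i \in G))%N.
Proof.
rewrite (cardsD1 i) !inE ltnSn andbT addnC; congr (_ + _)%N.
apply: eq_card => j; rewrite !inE -val_eqE /=; lia.
Qed.

Lemma subset_of_card n (G : {set 'I_n}) r : (r <= #|G|)%N ->
  exists2 K : {set 'I_n}, K \subset G & #|K| = r.
Proof.
elim: r => [|r IH] h; first by exists set0; rewrite ?sub0set ?cards0.
have [K KG Kr] := IH (ltnW h); have : K \proper G by rewrite properEcard KG Kr.
case/properP=> _ [i iG iK]; exists (i |: K); first by rewrite subUset sub1set iG.
by rewrite cardsU1 iK Kr.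
Qed.

Lemma beyond_setU1 n (S : {set 'I_n}) (c : 'I_n) z : c \notin S ->
  beyond (c |: S) z = ((z <= c) + beyond S z)%N.
Proof.
move=> cS; rewrite (beyondD z (subsetUr [set c] S)) addnC; congr (_ + _)%N.
rewrite /beyond (_ : _ :\: _ :\: _ = if (z <= c)%N then [set c] else set0).
  by case: ifP; rewrite ?cards1 ?cards0.
apply/setP => i; rewrite !inE -leqNgt.
have [->|ic] := eqVneq i c; first by rewrite cS /=; case: ifP; rewrite ?inE ?eqxx.
by case: ifP; rewrite ?inE ?(negbTE ic) /=; case: (i \in S); rewrite ?andbF.
Qed.

(** Matroid intersection in the special case where one of the families is closed
under moving elements down: the rank condition is then only needed on intervals.
Take F in the family, subject to the counting condition, with the least total
weight.  The least element c of F outside G leaves slack in the condition at c; the slack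
persists down to the nearest free position d below c, so moving c to d, or deleting
c if there is no such d, contradicts minimality.  Hence F is contained in G. *)
Lemma shifted_transversal n (P : pred {set 'I_n}) (F G : {set 'I_n}) r :
  (forall (c : 'I_n) (S : {set 'I_n}), c \notin S -> P (c |: S) -> P S) ->
  (forall (d c : 'I_n) (S : {set 'I_n}), (d < c)%N -> d \notin S -> c \notin S ->
    P (c |: S) -> P (d |: S)) ->
  P F -> (forall z, (z <= n)%N -> (r <= beyond F z + #|G :&: Lset n z|)%N) ->
  exists K : {set 'I_n}, [/\ K \subset G, #|K| = r & P K].
Proof.
move=> down shift PF0 rF0.
pose wide (X : {set 'I_n}) := [forall z : 'I_n.+1, r <= beyond X z + #|G :&: Lset n z|]%N.
have wideP X : reflect (forall z, (z <= n)%N -> (r <= beyond X z + #|G :&: Lset n z|)%N) (wide X).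
  apply: (iffP forallP) => [h z zn|h z]; last by apply: h; rewrite -ltnS.
  by have := h (Ordinal (zn : (z < n.+1)%N)).
have ok0 : P F && wide F by rewrite PF0; apply/wideP.
(* The successor makes the deletion of position 0 lower the weight as well. *)
pose weight (X : {set 'I_n}) := (\sum_(c in X) c.+1)%N.
have down_all (K X : {set 'I_n}) : K \subset X -> P X -> P K.
  move=> KX; have [d Ed] : exists d, #|X :\: K| = d by exists #|X :\: K|.
  elim: d X KX Ed => [|d IH] X KX Ed PX.
    suff -> : K = X by []; apply/eqP; rewrite eqEsubset KX.
    by rewrite -setD_eq0 -cards_eq0 Ed.
  have [c cX] : exists c, c \in X :\: K by apply/card_gt0P; rewrite Ed.
  have [cX1 cK] : c \in X /\ c \notin K by move: cX; rewrite inE => /andP[].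
  apply: (IH (X :\ c)); first by rewrite subsetD1 KX.
    move: Ed; rewrite (cardsD1 c) cX => -[<-]; apply: eq_card => i.
    by rewrite !inE; case: (i == c); rewrite ?andbF.
  by apply: (down c); rewrite ?setD1K // !inE eqxx.
have [X /andP[PX /wideP wX] minX] := @arg_minnP _ F (fun X => P X && wide X) weight ok0.
have {ok0} better Y : P Y -> wide Y -> (weight Y < weight X)%N -> False.
  by move=> PY wY; rewrite ltnNge minX // PY.
have XG : X \subset G.
  apply/negPn/negP => /subsetPn [c0 c0X c0G].
  have ok1 : c0 \in X :\: G by rewrite inE c0G.
  have [c cXG minc] := @arg_minnP _ c0 (fun c => c \in X :\: G) (fun c => val c) ok1.
  have [cX cG] : c \in X /\ c \notin G by move: cXG; rewrite inE => /andP[].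
  have wXc : weight X = (c.+1 + weight (X :\ c))%N by rewrite /weight (big_setD1 c).
  have bX z : beyond X z = ((z <= c) + beyond (X :\ c) z)%N.
    by rewrite -{1}(setD1K cX) beyond_setU1 // !inE eqxx.
  have low (d : 'I_n) : (d < c)%N -> d \in X -> d \in G.
    move=> dc dX; apply: contraLR dc => dG; rewrite -leqNgt.
    by apply: minc; rewrite inE dG.
  have slack j : (j <= c)%N -> forall z, (c - j <= z <= c)%N ->
      (r < beyond X z + #|G :&: Lset n z|)%N.
    elim: j => [|j IH] jc z zc.
      have -> : z = c by lia.
      by have := wX c.+1 (ltn_ord c); rewrite belowS beyondS cX (negbTE cG); lia.
    have [|zlt] := ltnP (c - j.+1) z; first by move=> h; apply: IH; lia.
    have zE : z = (c - j.+1)%N by lia.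
    have zn : (z < n)%N by have := ltn_ord c; lia.
    pose d := Ordinal zn; have dc : (d < c)%N by rewrite /= zE; lia.
    have IHj : (r < beyond X d.+1 + #|G :&: Lset n d.+1|)%N by apply: IH; rewrite /= ?zE; lia.
    case: (boolP (d \in X)) => dX.
      by move: IHj; rewrite -[z]/(nat_of_ord d) belowS (low d dc dX) beyondS dX; lia.
    exfalso; apply: (better (d |: (X :\ c))).
    - by apply: (shift d c) => //; rewrite ?setD1K // !inE ?eqxx // negb_and dX orbT.
    - apply/wideP => y yn; rewrite beyond_setU1; last by rewrite !inE negb_and dX orbT.
      have := wX y yn; rewrite bX; have := IH (ltnW jc) y; rewrite bX /=; lia.
    - rewrite wXc /weight big_setU1 ?ltn_add2r //.
      by rewrite !inE negb_and dX orbT.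
  apply: (better (X :\ c)).
  - by apply: (down c); rewrite ?setD1K // !inE eqxx.
  - apply/wideP => y yn; have := wX y yn; have := slack c (leqnn _) y; rewrite subnn bX; lia.
  - by rewrite wXc; lia.
have rX : (r <= #|X|)%N.
  have L0 : Lset n 0 = set0 by apply/setP => i; rewrite !inE.
  by have := wX 0%N (leq0n _); rewrite /beyond L0 setD0 setI0 cards0 addn0.
have [K KX Kr] := subset_of_card rX.
by exists K; split; [apply: subset_trans XG | | apply: down_all PX].
Qed.

(** * Independent columns of totally nonnegative matrices *)

Section TotallyNonnegative.
Variable R : realType.

Lemma rk_basis m n (B : 'M[R]_(m, n)) (Y : {set 'I_m}) J :
  exists K : {set 'I_m}, [/\ K \subset Y, #|K| = rk B Y J & rk B K J = #|K|].
Proof.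
have rk0 : rk B set0 J = #|@set0 'I_m| by apply/eqP; rewrite eqn_leq rk_le_card cards0.
by have [K [_ ? ? ?]] := rk_extend (sub0set Y) rk0; exists K.
Qed.

Lemma rk_free_subset m n (B : 'M[R]_(m, n)) (I K : {set 'I_m}) J :
  K \subset I -> rk B I J = #|I| -> rk B K J = #|K|.
Proof.
move=> KI rI; apply/eqP; rewrite eqn_leq rk_le_card /=.
by have := rk_rows B J KI; rewrite rI -{1}(cardsID K I) (setIidPr KI) leq_add2r.
Qed.

(** Extending bases along the flag gives one independent set that contains a basis
of each of its members. *)
Lemma rk_flag_basis m n (B : 'M[R]_(m, n)) (T : nat -> {set 'I_m}) J N :
  (forall t, T t \subset T t.+1) ->
  exists I : {set 'I_m}, rk B I J = #|I| /\
    forall t, (t <= N)%N -> (rk B (T t) J <= #|I :&: T t|)%N.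
Proof.
move=> Tmono; suff [I [_ rI h]] : exists I : {set 'I_m}, [/\ I \subset T N, rk B I J = #|I| &
    forall t, (t <= N)%N -> (rk B (T t) J <= #|I :&: T t|)%N] by exists I.
have ext t (I : {set 'I_m}) : I \subset T t -> rk B I J = #|I| -> exists K : {set 'I_m},
    [/\ I \subset K, K \subset T t, rk B K J = #|K| & (rk B (T t) J <= #|K :&: T t|)%N].
  move=> IT rI; have [K [IK KT cK rK]] := rk_extend IT rI.
  by exists K; split=> //; rewrite (setIidPl KT) cK.
elim: N => [|N [I [IT rI h]]].
  have [K [KT cK rK]] := rk_basis B (T 0%N) J.
  by exists K; split=> // t; rewrite leqn0 => /eqP ->; rewrite (setIidPl KT) cK.
have [K [IK KT rK hK]] := ext N.+1 I (subset_trans IT (Tmono N)) rI.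
exists K; split=> // t; rewrite leq_eqVlt => /orP[/eqP -> //|tN].
by apply: leq_trans (h t tN) _; apply: subset_leq_card; apply: setSI.
Qed.

(** Choose rows P on which S is a basis, a row i among the first y such that P + i is
independent on S + c, and, as B is invertible, a row l such that P + l is
independent on S + d.  If S + d were dependent on the first y rows, then i < l and the
minor on (P + i, S + d) would vanish, so that the Desnanot-Jacobi identity on
(P + i + l, S + d + c) would equate a nonnegative product with the negative of a
product of two positive minors. *)
Lemma column_exchange n (B : 'M[R]_n) y (S : {set 'I_n}) (d c : 'I_n) :
  totally_nonnegative B -> B \in unitmx ->
  (d < c)%N -> d \notin S -> c \notin S ->
  rk B (Lset n y) (c |: S) = #|c |: S| -> rk B (Lset n y) (d |: S) = #|d |: S|.
Proof.
move=> Bt Bu dc dS cS.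
have cards e : e \notin S -> #|e |: S| = #|S|.+1 by move=> eS; rewrite cardsU1 eS.
move=> rc; apply/eqP; rewrite eqn_leq rk_le_card_col leqNgt; apply/negP => rd.
have rS : rk B (Lset n y) S = #|S|.
  by rewrite -rk_tr; apply: (rk_free_subset (subsetUr [set c] S)); rewrite rk_tr.
have [P [PL cP rP]] := rk_basis B (Lset n y) S; rewrite rS in cP.
have rP1 e : rk B P (e |: S) = #|P|.
  by apply/eqP; rewrite eqn_leq rk_le_card -{1}rP rk_subset ?subsetUr.
have [|i [iL iP ri]] := rk_augment (Y := Lset n y) (rP1 c); first by rewrite rc cards // cP.
have [|l [_ lP rl]] := rk_augment (Y := setT) (rP1 d).
  by rewrite rk_unit_cols // cards // cP.
have cardP e : e \notin P -> #|e |: P| = #|S|.+1 by move=> eP; rewrite cardsU1 eP cP.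
have il : (i < l)%N.
  have : l \notin Lset n y.
    apply: contraL rd => lL; rewrite -leqNgt cards // -(cardP l) // -rl.
    by rewrite rk_subset // subUset sub1set lL.
  by move: iL; rewrite !inE; lia.
have zero : minor B (i |: P) (d |: S) = 0.
  apply/eqP; apply: contraTT rd; rewrite minor_neq0 ?cardP ?cards // => /eqP <-.
  by rewrite -leqNgt rk_subset // subUset sub1set iL.
have il' : i != l by rewrite -val_eqE neq_ltn il.
have dc' : d != c by rewrite -val_eqE neq_ltn dc.
have del1 (T : finType) (a b : T) (X : {set T}) : a \notin X -> a != b ->
    (a |: (b |: X)) :\ a = b |: X.
  by move=> aX ab; rewrite setU1K // !inE negb_or ab.
have del2 (T : finType) (a b : T) (X : {set T}) : b \notin X -> a != b ->
    (a |: (b |: X)) :\ b = a |: X.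
  by move=> bX ab; rewrite setUCA del1 // eq_sym.
have := @minor_desnanot _ _ _ B (i |: (l |: P)) (d |: (c |: S)) i l d c.
rewrite !del1 // !del2 // !setU1K // zero mulr0 sub0r => E.
have pos1 : 0 < minor B (l |: P) (d |: S) by rewrite minor_gt0 ?rl ?cardP ?cards.
have pos2 : 0 < minor B (i |: P) (c |: S) by rewrite minor_gt0 ?ri ?cardP ?cards.
have cU : #|i |: (l |: P)| = #|d |: (c |: S)|.
  by rewrite !cardsU1 !inE !negb_or il' dc' iP lP dS cS cP.
have := mulr_ge0 (Bt _ _ cU) (Bt P S cP); rewrite E ?inE ?eqxx ?orbT //.
by rewrite oppr_ge0 leNgt mulr_gt0.
Qed.

Lemma shifted_free_columns n (B : 'M[R]_n) y (F G : {set 'I_n}) r :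
  totally_nonnegative B -> B \in unitmx -> rk B (Lset n y) F = #|F| ->
  (forall z, (z <= n)%N -> (r <= beyond F z + #|G :&: Lset n z|)%N) ->
  exists K : {set 'I_n}, [/\ K \subset G, #|K| = r & rk B (Lset n y) K = r].
Proof.
move=> Bt Bu rF wide.
have [|||K [KG Kr /eqP rK]] :=
    @shifted_transversal n (fun X => rk B (Lset n y) X == #|X|) F G r _ _ _ wide.
- move=> c S cS /eqP h; apply/eqP; rewrite -rk_tr.
  by apply: (rk_free_subset (subsetUr [set c] S)); rewrite rk_tr.
- by move=> d c S dc dS cS /eqP h; apply/eqP; apply: column_exchange h.
- exact/eqP.
by exists K; rewrite rK Kr.
Qed.

(** * Corner ranks of products *)

(** The independent columns of the first y rows of B are closed under moving down, and
the rows of C are compared with them through a set G that contains bases for all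
initial segments of rows.  This gives a set K that is independent on both sides, hence
a positive term in the Cauchy-Binet expansion. *)
Lemma corner_mulmx_ge n (B C : 'M[R]_n) y x r :
  totally_nonnegative B -> B \in unitmx -> totally_nonnegative C ->
  (forall z, (z <= n)%N -> (r <= corner B y z + corner C z x)%N) ->
  (r <= corner (B *m C) y x)%N.
Proof.
move=> Bt Bu Ct h.
have [F [rF hF]] : exists F : {set 'I_n}, rk B (Lset n y) F = #|F| /\
    forall z, (z <= n)%N -> (corner B y z <= beyond F z)%N.
  have [|F [rF hF]] := @rk_flag_basis _ _ B^T (fun t => ~: Lset n (n - t)) (Lset n y) n.
    by move=> t; rewrite setCS Lset_sub // leq_sub2l.
  exists F; split=> [|z zn]; first by rewrite -rk_tr.
  by have := hF _ (leq_subr z n); rewrite rk_tr subKn // -setDE.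
have [|G [rG hG]] := @rk_flag_basis _ _ C (Lset n) (~: Lset n x) n.
  by move=> t; rewrite Lset_sub.
have [z zn|K [KG Kr rK]] := @shifted_free_columns n B y F G r Bt Bu rF.
  by apply: leq_trans (h z zn) _; rewrite leq_add ?hF ?hG.
have rKC := rk_free_subset KG rG.
have [I [IL cI rI]] := rk_basis B (Lset n y) K.
have [J [JR cJ rJ]] := rk_basis C^T (~: Lset n x) K.
rewrite rK in cI; rewrite rk_tr rKC Kr in cJ.
have IJ : #|I| = #|J| by rewrite cI.
have : 0 < minor (B *m C) I J.
  apply: (@minor_mul_gt0 _ _ _ _ _ _ I K J) => //; rewrite ?cI ?cJ ?Kr //.
    by rewrite minor_gt0 ?rI // cI Kr.
  by rewrite minor_gt0 ?Kr ?cJ // -rk_tr rJ cJ.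
rewrite minor_gt0 //; last exact: totally_nonnegative_mul.
by move=> /eqP rBC; rewrite -cI -rBC rk_subset.
Qed.

Lemma corner_minor_gt0 n (B : 'M[R]_n) k : totally_nonnegative B -> (k <= n)%N ->
  (0 < minor B (Lset n k) (Rset n k)) = (k <= corner B k (n - k))%N.
Proof.
move=> Bt kn; rewrite minor_gt0 ?card_Lset ?card_Rset // Rset_setC eqn_leq.
by have := rk_le_card B (Lset n k) (~: Lset n (n - k)); rewrite card_Lset // => ->.
Qed.

Lemma corner_square n (B : 'M[R]_n) k : totally_nonnegative B -> (k <= n)%N ->
  0 < minor (B *m B) (Lset n k) (Rset n k) ->
  forall z, (k <= corner B k z + corner B z (n - k))%N.
Proof.
move=> Bt kn; rewrite corner_minor_gt0 //; last exact: totally_nonnegative_mul.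
by move=> h z; apply: leq_trans h (corner_mulmx_le _ _ _ _ _).
Qed.

Lemma corner_cube n (B : 'M[R]_n) k : totally_nonnegative B -> B \in unitmx -> (k <= n)%N ->
  (forall z z', (z <= n)%N -> (z' <= n)%N ->
     (k <= corner B k z + corner B z z' + corner B z' (n - k))%N) ->
  0 < minor (B *m (B *m B)) (Lset n k) (Rset n k).
Proof.
move=> Bt Bu kn h; have BBt := totally_nonnegative_mul Bt Bt.
rewrite corner_minor_gt0 //; last exact: totally_nonnegative_mul.
apply: corner_mulmx_ge => // z zn; rewrite -leq_subLR.
by apply: corner_mulmx_ge => // z' z'n; rewrite leq_subLR addnA h.
Qed.

Lemma corner_minor_step_up n (B : 'M[R]_n) k : (3 <= k)%N -> (k + 4 <= n)%N ->
  B \in unitmx -> totally_nonnegative B ->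
  0 < minor (B *m B) (Lset n k) (Rset n k) ->
  0 < minor (B *m (B *m B)) (Lset n (k + 2)) (Rset n (k + 2)).
Proof.
move=> k3 k4 Bu Bt h; have kn : (k <= n)%N by lia.
apply: corner_cube => //; first by lia.
apply: two_to_three_steps => // [|z _]; first exact: corner_count_corner.
exact: corner_square.
Qed.

(** The dual counts satisfy the hypothesis of the inequality for n - (k + 2), and its
conclusion for them is the one needed for k. *)
Lemma corner_minor_step_down n (B : 'M[R]_n) k : (2 <= k)%N -> (k + 5 <= n)%N ->
  B \in unitmx -> totally_nonnegative B ->
  0 < minor (B *m B) (Lset n (k + 2)) (Rset n (k + 2)) ->
  0 < minor (B *m (B *m B)) (Lset n k) (Rset n k).
Proof.
move=> k2 k5 Bu Bt h; have kn : (k + 2 <= n)%N by lia.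
have sq := corner_square Bt kn h; have cc := corner_count_corner Bu.
apply: corner_cube => // [|z z' zn z'n]; first by lia.
have := @two_to_three_steps n _ (n - (k + 2)) (corner_count_dual cc).
have -> : (n - (k + 2) + 2 = n - k)%N by lia.
have -> : (n - (n - (k + 2)) = k + 2)%N by lia.
have -> : (n - (n - k) = k)%N by lia.
have dual_sq : forall t, (t <= n)%N ->
    (n - (k + 2) <= corner B t (n - (k + 2)) + (n - (k + 2)) - t +
      (corner B (k + 2) t + t - (k + 2)))%N.
  move=> t tn; have := sq t; have := cc_ge cc tn (leq_subr (k + 2) n).
  have := cc_ge cc kn tn; lia.
have k3' : (3 <= n - (k + 2))%N by lia.
have k4' : (n - (k + 2) + 4 <= n)%N by lia.
move=> /(_ k3' k4' dual_sq z' z z'n zn).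
have kn' : (k <= n)%N by lia.
have := cc_ge cc z'n (leq_subr k n); have := cc_ge cc zn z'n; have := cc_ge cc kn' zn; lia.
Qed.

(** * All minors of a given order *)

(** Since R_k is independent on the first k rows, so is every set of k columns, as it
lies below R_k; the same holds for the transpose.  For other I and J, lower one
element of each, to get I' and J'.  Desnanot-Jacobi gives that the product of
the minors (I, J) and (I', J') is at least that of (I, J') and (I', J), so
positivity propagates upward. *)
Lemma minors_pos_corners n (B : 'M[R]_n) k : (k <= n)%N ->
  B \in unitmx -> totally_nonnegative B ->
  0 < minor B (Lset n k) (Rset n k) -> 0 < minor B^T (Lset n k) (Rset n k) ->
  minors_pos k B.
Proof.
move=> kn; have cL := card_Lset kn; have cR := card_Rset kn.
have first_rows (C : 'M[R]_n) (J : {set 'I_n}) : C \in unitmx -> totally_nonnegative C ->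
    0 < minor C (Lset n k) (Rset n k) -> #|J| = k -> 0 < minor C (Lset n k) J.
  move=> Cu Ct; rewrite minor_gt0 ?cL // => /eqP rC cJ.
  have [||K [KJ cK rK]] := @shifted_free_columns n C k (Rset n k) J k Ct Cu.
  - by rewrite rC cR.
  - move=> z zn; rewrite Rset_setC /beyond -{1}cJ -(cardsID (Lset n z) J) addnC leq_add2r.
    have [zk|kz] := leqP z (n - k).
      rewrite (_ : ~: Lset n (n - k) :\: Lset n z = ~: Lset n (n - k)).
        rewrite card_LsetC ?leq_subr // subKn // -[X in (_ <= X)%N]cJ.
        exact/subset_leq_card/subsetDl.
      apply/setP => i; rewrite !inE -!leqNgt; lia.
    apply: subset_leq_card; apply/subsetP => i; rewrite !inE => /andP[iz _]; lia.
  have <- : K = J by apply/eqP; rewrite eqEcard KJ cJ cK leqnn.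
  by rewrite minor_gt0 ?cL ?cK // rK.
move=> Bu Bt LR RL I J cI cJ.
have firstJ (X : {set 'I_n}) : #|X| = k -> 0 < minor B (Lset n k) X by move=> cX; apply: first_rows.
have firstI (X : {set 'I_n}) : #|X| = k -> 0 < minor B X (Lset n k).
  move=> cX; rewrite -minor_tr ?cX ?cL //; apply: first_rows; rewrite ?unitmx_tr //.
  exact: totally_nonnegative_tr.
have lower (X : {set 'I_n}) : #|X| = k -> X != Lset n k ->
    exists a b : 'I_n, [/\ (a < b)%N, a \notin X & b \in X].
  move=> cX XL; have [a aL aX] : exists2 a, a \in Lset n k & a \notin X.
    by apply/subsetPn; apply: contra (XL) => LX; rewrite eq_sym eqEcard LX cX cL leqnn.
  have [b bX bL] : exists2 b, b \in X & b \notin Lset n k.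
    by apply/subsetPn; apply: contra (XL) => LX; rewrite eqEcard LX cX cL leqnn.
  by exists a, b; split=> //; move: aL bL; rewrite !inE; lia.
pose weight (X : {set 'I_n}) := (\sum_(c in X) c)%N.
have weightU (S : {set 'I_n}) a : a \notin S -> weight (a |: S) = (a + weight S)%N.
  by move=> aS; rewrite /weight big_setU1.
have [w] := ubnP (weight I + weight J)%N.
elim: w I J cI cJ => // w IH I J cI cJ wIJ.
have [->|IL] := eqVneq I (Lset n k); first exact: firstJ.
have [->|JL] := eqVneq J (Lset n k); first exact: firstI.
have [a [b [ab aI bI]]] := lower I cI IL; have [c [d [cd cJ' dJ]]] := lower J cJ JL.
have split1 (X : {set 'I_n}) (e f : 'I_n) : #|X| = k -> (e < f)%N -> e \notin X -> f \in X ->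
    [/\ #|e |: (X :\ f)| = k, (weight (e |: (X :\ f)) < weight X)%N &
       (e |: X) :\ f = e |: (X :\ f)].
  move=> cX ef eX fX; have eX' : e \notin X :\ f by rewrite !inE negb_and eX orbT.
  have ne : f != e by rewrite -val_eqE neq_ltn ef orbT.
  split.
  - by rewrite cardsU1 eX' -cX (cardsD1 f X) fX.
  - by rewrite weightU // -[X in (_ < weight X)%N](setD1K fX) weightU ?ltn_add2r // !inE eqxx.
  - by rewrite setDUl; congr (_ :|: _); apply/setDidPl; rewrite disjoints1 inE eq_sym.
have [cI' wI' eI] := split1 I a b cI ab aI bI; have [cJ'' wJ' eJ] := split1 J c d cJ cd cJ' dJ.
set I' := a |: (I :\ b) in cI' wI' eI; set J' := c |: (J :\ d) in cJ'' wJ' eJ.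
have cIJ : #|a |: I| = #|c |: J| by rewrite !cardsU1 aI cJ' cI cJ.
have := @minor_desnanot _ _ _ B (a |: I) (c |: J) a b c d cIJ.
rewrite !inE !eqxx bI dJ !orbT => /(_ isT isT ab isT isT cd).
rewrite !setU1K // eI eJ => E.
have p1 : 0 < minor B I J' by apply: IH => //; clear -wIJ wJ'; lia.
have p2 : 0 < minor B I' J by apply: IH => //; clear -wIJ wI'; lia.
have p3 : 0 < minor B I' J' by apply: IH => //; clear -wIJ wI' wJ'; lia.
rewrite -(pmulr_lgt0 _ p3).
move/eqP: E; rewrite eq_sym subr_eq => /eqP ->.
apply: ltr_wpDl; last by rewrite mulr_gt0.
apply: mulr_ge0; apply: Bt => //.
by rewrite -[I :\ b]setIid; move: cI cJ; rewrite (cardsD1 b I) (cardsD1 d J) bI dJ setIid => <- [].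
Qed.

Lemma oscillatory_unit n (A : 'M[R]_n) : oscillatory A -> A \in unitmx.
Proof.
case=> _ [m [m0 Am]].
have : A ^+ m \in unitmx.
  by rewrite unitmxE unitfE -minor_setT; apply: lt0r_neq0; apply: Am.
by case: m m0 {Am} => // m _; rewrite exprS -mulmxE unitmx_mul => /andP[].
Qed.

Lemma minors_pos_square n (A : 'M[R]_n) k : totally_nonnegative A ->
  leqoo (exponent k A) 2 -> minors_pos k (A *m A).
Proof.
move=> At /leqoo_least_pos [[|[|[|m]]] [// _]]; rewrite ?exprS ?expr0 ?mulr1 // => Ap I J cI cJ.
by apply: (@minor_mul_gt0 _ _ _ _ _ _ I I J) => //; rewrite ?cI ?cJ //; apply: Ap.
Qed.

Lemma exponent_cube n (A : 'M[R]_n) k l : (k <= n)%N -> (l <= n)%N ->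
  (forall B : 'M[R]_n, B \in unitmx -> totally_nonnegative B ->
    0 < minor (B *m B) (Lset n k) (Rset n k) ->
    0 < minor (B *m (B *m B)) (Lset n l) (Rset n l)) ->
  oscillatory A -> leqoo (exponent k A) 2 -> leqoo (exponent l A) 3.
Proof.
move=> kn ln step oscA e2; have Au := oscillatory_unit oscA; case: (oscA) => At _.
have sq := minors_pos_square At e2; apply/leqoo_least_pos; exists 3%N; split=> //.
have -> : A ^+ 3 = A *m (A *m A) by rewrite !exprS expr0 mulr1 !mulmxE.
have Att := totally_nonnegative_tr At.
apply: minors_pos_corners => //.
- by rewrite !unitmx_mul Au.
- by do 2?apply: totally_nonnegative_mul.
- by apply: step => //; apply: sq; rewrite ?card_Lset ?card_Rset.
rewrite !trmx_mul -mulmxA; apply: step; rewrite ?unitmx_tr // -trmx_mul minor_tr.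
  by apply: sq; rewrite ?card_Lset ?card_Rset.
by rewrite card_Lset ?card_Rset.
Qed.

End TotallyNonnegative.

Theorem theorem8p3 (R : realType) (n : nat) :
  (forall (Q : seq 'I_n.-1) (k : nat), (3 <= k)%N -> (k + 4 <= n)%N ->
     leqoo (pass_time k Q) 2 -> leqoo (pass_time (k + 2) Q) 3)
  /\
  (forall (B : 'M[R]_n) (k : nat), (3 <= k)%N -> (k + 4 <= n)%N ->
     B \in unitmx -> totally_nonnegative B ->
     0 < minor (B ^+ 2) (Lset n k) (Rset n k) ->
     0 < minor (B ^+ 3) (Lset n (k + 2)) (Rset n (k + 2)))
  /\
  (forall (A : 'M[R]_n) (k : nat), (3 <= k)%N -> (k + 4 <= n)%N ->
     oscillatory A ->
     leqoo (exponent k A) 2 -> leqoo (exponent (k + 2) A) 3)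
  /\
  (forall (A : 'M[R]_n) (k : nat), (2 <= k)%N -> (k + 5 <= n)%N ->
     oscillatory A ->
     leqoo (exponent (k + 2) A) 2 -> leqoo (exponent k A) 3).
Proof.
split; first by move=> Q k; exact: pass_time_step.
split; first by move=> B k k3 k4; rewrite !exprS expr0 mulr1 -!mulmxE; exact: corner_minor_step_up.
split=> A k k_ge k_le; apply: exponent_cube; do ?by lia.
  by move=> B; apply: corner_minor_step_up.
by move=> B; apply: corner_minor_step_down.
Qed.
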